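(* Let $G$ be a graph, $\mathcal C$ a hole cover of $G$, $(\mathcal C_1,\dots,\mathcal C_\ell)$ a local chordalization partition of $\mathcal C$, and $G^*=G_\ell^*$ the last graph of the corresponding chordalization chain. If $K\subseteq V(G)$ is a clique in $G^*$, then there is a subset $\mathcal C^*\subseteq K\cap\mathcal C$ such that $K\setminus\mathcal C^*$ is a clique in $G$ and $|\mathcal C^*\cap\mathcal C_i|\le 1$ for each $i=1,\dots,\ell$.
   Context: All graphs are finite and simple. A hole of $G$ is an induced cycle of length at least $4$; $G$ is chordal if it has no hole. $\mathcal H(G)$ is the set of holes and $\mathcal H(G,u)$ those containing $u$. A hole cover of $G$ is a nonempty $X\subseteq V(G)$ meeting every hole (any nonempty set if $G$ is chordal). A vertex $u$ satisfies the NC property in $G$ if there are no holes $H\in\mathcal H(G,u)$, $H'\in\mathcal H(G)\setminus\mathcal H(G,u)$ sharing two consecutive edges (two distinct edges with a common end vertex lying on both). A set $\mathcal C$ satisfies the NC property in $G$ if each of its vertices does and every hole contains at most one vertex of $\mathcal C$. Locally chordalizing all holes in $\mathcal H(G,u)$ by $u$ means adding all edges $uw$ with $w\ne u$ lying on some hole in $\mathcal H(G,u)$. For a hole cover $\mathcal C=\{u_1,\dots,u_k\}$ satisfying the NC property in $G$, set $G_0=G$, obtain $G_i$ from $G_{i-1}$ by locally chordalizing all holes in $\mathcal H(G_{i-1},u_i)$ by $u_i$, and put $\widehat G(\mathcal C)=G_k$ (independent of the ordering). Given a hole cover $\mathcal C$ of $G$, an ordered partition $(\mathcal C_1,\dots,\mathcal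 C_\ell)$ of $\mathcal C$ into nonempty parts is a local chordalization partition if, with $G_0=G_0^*=G-\mathcal C$ and, for $i=1,\dots,\ell$, $G_i$ the graph with $V(G_i)=V(G_{i-1}^* )\cup\mathcal C_i$ and $E(G_i)=E(G_{i-1}^* )\cup E\big(G-\bigcup_{j=i+1}^{\ell}\mathcal C_j\big)$ and $G_i^*=\widehat{G_i}(\mathcal C_i)$, each $\mathcal C_i$ is a hole cover of $G_i$ satisfying the NC property in $G_i$ and each $G_i^*$ is chordal. The sequence $G_0,G_0^*,\dots,G_\ell,G_\ell^*$ is the chordalization chain. *)

(* Defs.v *)
From mathcomp Require Import all_boot.
Set Implicit Arguments. Unset Strict Implicit. Unset Printing Implicit Defensive.

Section Graphs.
Variable T : finType.

(* A finite simple graph on the ambient finite type T: a vertex set and a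
   (Prop-valued) edge relation; adjacency is restricted to vertices of the
   graph, made irreflexive and symmetric by [adj]. *)
Record graph := Graph { gV : {set T}; gA : T -> T -> Prop }.

Definition adj (G : graph) (x y : T) : Prop :=
  [/\ x \in gV G, y \in gV G, x != y & (gA G x y \/ gA G y x)].

Definition hole (G : graph) (H : {set T}) : Prop :=
  exists s : seq T,
    [/\ uniq s, 4 <= size s, H = [set x in s], {subset s <= gV G} &
        forall x y, x \in s -> y \in s ->
          (adj G x y <-> (y == next s x) || (y == prev s x))].

Definition chordal (G : graph) : Prop := forall H, ~ hole G H.

Definition clique (G : graph) (K : {set T}) : Prop :=
  K \subset gV G /\ forall x y, x \in K -> y \in K -> x != y -> adj G x y.

Definition hole_cover (G : graph) (X : {set T}) : Prop :=
  [/\ X \subset gV G, X != set0 &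
      forall H, hole G H -> H :&: X != set0].

(* Holes H and H' share two consecutive edges ab, bc (a <> c); edges of a
   hole are the graph edges between its vertices (holes are induced). *)
Definition share_two_consec (G : graph) (H H' : {set T}) : Prop :=
  exists a b c, [/\ a != c, adj G a b, adj G b c,
                    [/\ a \in H, b \in H & c \in H] &
                    [/\ a \in H', b \in H' & c \in H']].

Definition NC_vertex (G : graph) (u : T) : Prop :=
  ~ exists H H', [/\ hole G H, hole G H', u \in H, u \notin H' &
                     share_two_consec G H H'].

Definition NC_set (G : graph) (C : {set T}) : Prop :=
  (forall u, u \in C -> NC_vertex G u) /\
  (forall H, hole G H -> #|H :&: C| <= 1).

Definition local_chordalize (G : graph) (u : T) : graph :=
  Graph (gV G) (fun x y => adj G x y \/
     [/\ x = u, y <> u & exists H, [/\ hole G H, u \in H & y \in H]]).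

(* \hat G(C): successive local chordalizations by the vertices of C
   (in the order of enum C; the paper asserts independence of the order). *)
Definition hatG (G : graph) (C : {set T}) : graph :=
  foldl local_chordalize G (enum C).

Definition delete (G : graph) (S : {set T}) : graph :=
  Graph (gV G :\: S) (gA G).

Definition part (Cs : seq {set T}) (i : nat) : {set T} := nth set0 Cs i.-1.

Definition later_parts (Cs : seq {set T}) (i : nat) : {set T} :=
  \bigcup_(A <- drop i Cs) A.

Definition step_graph (G : graph) (Cs : seq {set T}) (Gprev : graph) (i : nat)
  : graph :=
  Graph (gV Gprev :|: part Cs i)
        (fun x y => adj Gprev x y \/ adj (delete G (later_parts Cs i)) x y).

Fixpoint chain_star (G : graph) (C : {set T}) (Cs : seq {set T}) (i : nat)
  : graph :=
  match i with
  | 0 => delete G C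
  | i'.+1 => hatG (step_graph G Cs (chain_star G C Cs i') i) (part Cs i)
  end.

Definition chain_G (G : graph) (C : {set T}) (Cs : seq {set T}) (i : nat)
  : graph :=
  match i with
  | 0 => delete G C
  | i'.+1 => step_graph G Cs (chain_star G C Cs i') i
  end.

Definition local_chordalization_partition (G : graph) (C : {set T})
  (Cs : seq {set T}) : Prop :=
  [/\ forall A, A \in Cs -> A != set0,
      forall i j, i < j < size Cs -> [disjoint nth set0 Cs i & nth set0 Cs j],
      \bigcup_(A <- Cs) A = C &
      forall i, 1 <= i <= size Cs ->
        [/\ hole_cover (chain_G G C Cs i) (part Cs i),
            NC_set (chain_G G C Cs i) (part Cs i) &
            chordal (chain_star G C Cs i)]].

End Graphs.

(* Main.v *)
Require Import Defs.
From mathcomp Require Import all_boot.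
From mathcomp Require Import boolp zify.

Set Implicit Arguments.
Unset Strict Implicit.
Unset Printing Implicit Defensive.

(**
One chordalization step changes a clique by at most one vertex. Let A be a set
with the NC property in G.

If u satisfies the NC property, chordalizing by u creates no hole. A hole of
the new graph through u would run u, a, R, b with, say, ua a new edge, so a lies
on a hole H of G through u. Suitable paths from a and from b back to u must
touch each other, since otherwise some hole of G passes through u and R, which
would make u adjacent to a vertex of R. But then they close up to a hole
avoiding u and containing the two edges of H at a (or of the hole through b at
b), against the NC property. Hence every edge added to G when forming the hat
graph of A joins some u in A to a vertex outside A lying with u on a hole of G.

If a clique of the hat graph contains new edges uw and vz with u <> v in A, then
uv is an edge of G. When w = z, the edge uv and the two holes produce a hole
through both u and v, or one sharing two edges at w with the hole of u and
avoiding u (or the same with u and v exchanged). When w <> z and both uz and vw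
are old, u, z, w, v is a hole of length 4 through u and v. So all new edges
inside a clique share their end in A, and deleting that vertex leaves a clique
of G. The theorem follows by descending along the chain, as the edges of G_i at
vertices of C_i are edges of G.
*)

(** * Cyclic sequences and induced cycles *)

Lemma next_nth_modn (T : eqType) (x0 : T) (s : seq T) i :
  uniq s -> i < size s -> next s (nth x0 s i) = nth x0 s (i.+1 %% size s).
Proof.
move=> Us lti; rewrite next_nth mem_nth // index_uniq //.
case: s Us lti => // y p _ /= lti.
have [ltip | leip] := ltnP i (size p).
  by rewrite modn_small //=; apply: set_nth_default.
have -> : i = size p by apply/eqP; rewrite eqn_leq leip -ltnS lti.
by rewrite modnn nth_default.
Qed.

Section Adjacency.
Variable T : finType.
Implicit Types (G : graph T) (A B S H : {set T}) (s p : seq T).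

Definition adjb G : rel T := fun x y => `[< adj G x y >].

Lemma adjbP G x y : reflect (adj G x y) (adjb G x y).
Proof. exact: asboolP. Qed.

Lemma adjC G x y : adj G x y -> adj G y x.
Proof. by case=> xV yV nxy [Exy|Eyx]; split; rewrite // 1?eq_sym //; [right|left]. Qed.

Lemma adjbC G : symmetric (adjb G).
Proof. by move=> x y; apply/adjbP/adjbP; apply: adjC. Qed.

Lemma adjbxx G : irreflexive (adjb G).
Proof. by move=> x; apply/adjbP; case=> _ _; rewrite eqxx. Qed.

(** Holes in index form: only pairs [i < j] are constrained, since [adjb] is symmetric and
    irreflexive. The second disjunct is the edge closing the cycle. *)
Definition induced_cycle G s :=
  [/\ uniq s, 4 <= size s & forall x0 i j, i < j < size s ->
    adjb G (nth x0 s i) (nth x0 s j)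
      = (j == i.+1) || (i == 0) && (j.+1 == size s)].

(** Applying [next] to both sides of the equation with [prev] leaves only successors, which are
    indices plus one modulo [size s]; as [i < j], only [j] can wrap around, and then to 0. *)
Lemma cycle_nbrE (x0 : T) s i j : uniq s -> i < j < size s ->
  (nth x0 s j == next s (nth x0 s i)) || (nth x0 s j == prev s (nth x0 s i))
    = (j == i.+1) || (i == 0) && (j.+1 == size s).
Proof.
move=> Us /andP[ltij ltj]; have lti := ltn_trans ltij ltj.
rewrite -[nth x0 s j == prev _ _](inj_eq (can_inj (prev_next Us))) next_prev //.
have s0 : 0 < size s by lia.
rewrite !next_nth_modn // !nth_uniq ?ltn_pmod //.
rewrite (@modn_small i.+1); last exact: leq_ltn_trans ltj.
congr (_ || _).
have [->|nej] := eqVneq j.+1 (size s).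
  by rewrite modnn andbT eq_sym.
rewrite modn_small; last by rewrite ltn_neqAle nej.
by rewrite andbF; apply/eqP; move: ltij => /[swap] <-; rewrite ltnNge leqnSn.
Qed.

Lemma hole_of_cycle G s : induced_cycle G s -> hole G [set x in s].
Proof.
case=> Us sz Es; exists s; split=> // [x xs|x y xs ys].
  rewrite -(nth_index x xs).
  have lti : index x s < size s by rewrite index_mem.
  have [lti'|lei] := ltnP (index x s).+1 (size s).
    have /adjbP[] // : adjb G (nth x s (index x s)) (nth x s (index x s).+1).
    by rewrite Es ?ltnSn ?lti' // eqxx.
  have /adjbP[] // : adjb G (nth x s 0) (nth x s (index x s)).
  by rewrite Es; lia.
rewrite -(nth_index x xs) -(nth_index x ys).
have ltx : index x s < size s by rewrite index_mem.
have lty : index y s < size s by rewrite index_mem.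
move: (index x s) (index y s) ltx lty => i j ltx lty.
apply: (iff_trans (rwP (adjbP _ _ _)) _).
case: (ltngtP i j) => [ltij|ltji|->].
- by rewrite Es ?ltij // cycle_nbrE ?ltij.
- rewrite adjbC Es ?ltji // -(@cycle_nbrE x) ?ltji //.
  have K1 := prev_next Us; have K2 := next_prev Us.
  by rewrite (eq_sym (nth x s i)) (can2_eq K1 K2) orbC
    (eq_sym (nth x s i)) (can2_eq K2 K1).
rewrite adjbxx -[_ == prev _ _](inj_eq (can_inj (prev_next Us))) next_prev //.
have s0 : 0 < size s by apply: leq_trans sz.
rewrite next_nth_modn // !nth_uniq ?ltn_pmod //.
suff E : (j == j.+1 %% size s) = false by rewrite [in X in _ || X]eq_sym E.
have [ej|nej] := eqVneq j.+1 (size s); first by rewrite ej modnn; lia.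
by rewrite modn_small; lia.
Qed.

(** Rotating the sequence of the hole brings [u] to the front, and [next] and [prev] are invariant
    under rotation. *)
Lemma cycle_of_hole G H u : hole G H -> u \in H ->
  exists p, H = [set x in u :: p] /\ induced_cycle G (u :: p).
Proof.
case=> s [Us sz -> _ Es]; rewrite inE => /rot_to[k p def_p]; exists p.
have eqs : u :: p =i s by move=> x; rewrite -def_p mem_rot.
split; first by apply/setP=> x; rewrite !inE -eqs inE.
have Up : uniq (u :: p) by rewrite -def_p rot_uniq.
have szp : size (u :: p) = size s by rewrite -def_p size_rot.
split; rewrite ?szp // => x0 i j lt_ij.
have [ltij ltj] := andP lt_ij.
rewrite -szp -(@cycle_nbrE x0) // ?szp // -def_p next_rot // prev_rot // def_p.
apply/adjbP/idP => [|h]; [move/Es; apply|apply/Es=> //];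
  by rewrite -eqs mem_nth // szp // (ltn_trans ltij).
Qed.

(** * Connected vertex sets and sets that touch *)

Definition induced_adj G S : rel T :=
  fun x y => [&& x \in S, y \in S & adjb G x y].

Definition connected_in G S :=
  {in S &, forall x y, connect (induced_adj G S) x y}.

(** A common vertex counts as touching, so that touching is what makes the union of two connected
    sets connected. *)
Definition touch G A B :=
  exists x y, [/\ x \in A, y \in B & x = y \/ adjb G x y].

Lemma touchC G A B : touch G A B -> touch G B A.
Proof.
case=> x [y [xA yB xy]]; exists y, x; split=> //.
by case: xy => [->|xy]; [left | right; rewrite adjbC].
Qed.

Lemma induced_connectC G S : connect_sym (induced_adj G S).
Proof.
by apply: sym_connect_sym => x y; rewrite /induced_adj adjbC andbCA.
Qed.

Lemma induced_connectS G A B x y : A \subset B ->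
  connect (induced_adj G A) x y -> connect (induced_adj G B) x y.
Proof.
move=> /subsetP sAB; apply: connect_sub => a b /and3P[aA bA ab].
by apply: connect1; rewrite /induced_adj !sAB.
Qed.

Lemma connected_in1 G x : connected_in G [set x].
Proof. by move=> y z /set1P-> /set1P->. Qed.

Lemma connected_inU G A B : connected_in G A -> connected_in G B ->
  touch G A B -> connected_in G (A :|: B).
Proof.
move=> cA cB [a [b [aA bB ab]]].
have cAB : {in A & B, forall x y, connect (induced_adj G (A :|: B)) x y}.
  move=> x y xA yB.
  apply: (connect_trans (induced_connectS (subsetUl A B) (cA _ _ xA aA))).
  apply: connect_trans (induced_connectS (subsetUr A B) (cB _ _ bB yB)).
  case: ab => [->//|ab]; apply: connect1.
  by rewrite /induced_adj !inE aA bB orbT.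
move=> x y /setUP[xA|xB] /setUP[yA|yB].
- exact: induced_connectS (subsetUl _ _) (cA _ _ xA yA).
- exact: cAB.
- by rewrite induced_connectC cAB.
- exact: induced_connectS (subsetUr _ _) (cB _ _ xB yB).
Qed.

Lemma last_take_nth (x0 y : T) p k :
  k <= size p -> last y (take k p) = nth x0 (y :: p) k.
Proof.
elim: p y k => [|z p IH] y [|k] //= lek; rewrite IH //.
Qed.

(* The hole is closed up by u along a shortest path of G[S] from y to another
   neighbour of u. *)
Lemma apex_cycle G S u x y : connected_in G S -> u \notin S ->
    x \in S -> y \in S -> x != y -> adjb G u x -> adjb G u y ->
    (forall z, z \in S -> adjb G u z -> ~~ adjb G y z) ->
  exists p, induced_cycle G (u :: y :: p) /\ {subset y :: p <= S}.
Proof.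
move=> cS uS xS yS nxy ux uy nocommon.
(* [y] is itself a neighbour of [u], so the end of the path has to be kept different from [y]. *)
pose good p := [&& uniq (y :: p), path (adjb G) y p, all (mem S) p,
  adjb G u (last y p) & last y p != y].
have ex_good : exists n, [exists t : n.-tuple T, good t].
  have /connectP[p0 pp0 ex] := cS y x yS xS.
  case/shortenP: pp0 ex => p pp Up _ ex.
  exists (size p); apply/existsP; exists (in_tuple p); rewrite /good /= -ex.
  rewrite ux nxy !andbT -[(_ \notin _) && _]/(uniq (y :: p)) Up /=.
  apply/andP; split; first by apply: sub_path pp => a b /and3P[].
  by elim: p y {Up ex cS yS nxy uy nocommon good} pp
    => //= z p IH y /andP[/and3P[_ -> _]] /IH.
case: (ex_minnP ex_good) => n /existsP[t good_t] min_t.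
have min q : good q -> size t <= size q.
  move=> good_q; rewrite size_tuple; apply: min_t.
  by apply/existsP; exists (in_tuple q).
move: (tval t) good_t min => p {min_t t n} /and5P[Up pp pS ul nly] min.
(* If [p] were a single vertex, it would be a common neighbour of [u] and [y]. Hence the cycle has
   length at least 4. *)
have sp : 2 <= size p.
  case: p pp ul nly pS {Up min} => [|z [|]] //=; first by rewrite eqxx.
  by rewrite !andbT => yz uz _ zS; move: (nocommon z zS uz); rewrite yz.
exists p; split; last first.
  by move=> z; rewrite inE => /predU1P[-> //|zp]; apply: (allP pS).
have upn : u \notin y :: p.
  by apply: contra uS; rewrite inE => /predU1P[->//|up]; apply: (allP pS).
split; rewrite ?cons_uniq ?upn // => x0 [|i] [|j] // /andP[ltij ltj] /=;
  rewrite /= !ltnS in ltj.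
  rewrite !eqSS; have [->|j0] /= := posnP j; first by rewrite uy.
  have [ej|nej] := eqVneq j (size p).
    by rewrite ej -last_take_nth // take_size.
  (* At an earlier neighbour of [u] the path could stop, against minimality. *)
  apply/negP => uj.
  have ltjp : j < size p by rewrite ltn_neqAle nej.
  suff /min : good (take j p) by rewrite size_take ltjp leqNgt ltjp.
  have el := last_take_nth x0 y (ltnW ltjp).
  rewrite /good el uj take_path // (subseq_uniq _ Up) /=; last first.
    by rewrite eqxx take_subseq.
  have -> /= : all (mem S) (take j p) 
    by apply/allP => z /mem_take zp; apply: (allP pS).
  by rewrite -[X in _ != X]/(nth x0 (y :: p) 0) nth_uniq // -?lt0n //= ltnW.
rewrite !eqSS /= orbF; rewrite ltnS in ltij.
have split_j : path (adjb G) (nth x0 (y :: p) j) (drop j p)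
    /\ last (nth x0 (y :: p) j) (drop j p) = last y p.
  rewrite -(last_take_nth x0 y ltj) -last_cat cat_take_drop; split=> //.
  by move: pp; rewrite -[in path _ _ _](cat_take_drop j p) cat_path => /andP[].
have [ej|nej] := eqVneq j i.+1.
  by rewrite ej; apply: (pathP x0 pp); rewrite -ej.
(* A chord between the vertices of index [i] and [j] of [y :: p] gives a shortcut. Indices in [p]
   are one lower, so [take i p] ends at the first vertex and [drop j.-1 p] starts at the second. *)
apply/negP => eij; have ltjp : j.-1 < size p by clear -ltij ltj; lia.
pose q := take i p ++ drop j.-1 p.
suff /min : good q.
  rewrite size_cat size_take size_drop (leq_trans ltij ltj).
  by clear -ltij ltj nej; lia.
have dropE : drop j.-1 p = nth x0 (y :: p) j :: drop j p.
  by rewrite (drop_nth x0 ltjp); case: j {split_j nej eij q ltj} ltij ltjp.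
have lastq : last y q = last y p.
  by rewrite last_cat dropE /=; case: split_j.
rewrite /good lastq ul nly !andbT; apply/and3P; split.
- apply: subseq_uniq Up; rewrite -[_ :: q]/([:: y] ++ q) /= eqxx.
  rewrite -[X in subseq _ X](cat_take_drop i p) cat_subseq //.
  have -> : j.-1 = j.-1 - i + i by clear -ltij nej; lia.
  by rewrite -drop_drop drop_subseq.
- rewrite cat_path take_path // dropE /= (last_take_nth x0);
    last by clear -ltij ltj; lia.
  by rewrite eij; case: split_j.
- rewrite all_cat; apply/andP; split; apply/allP => z zq;
    apply: (allP pS); [exact: mem_take zq | exact: mem_drop zq].
Qed.

(** * Segments of a cycle and the two arms of a hole *)

Definition segment (x0 : T) s a b : {set T} :=
  [set x | [exists i : 'I_b, (a <= i) && (x == nth x0 s i)]].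

Lemma segmentP (x0 : T) s a b x :
  reflect (exists2 i, a <= i < b & x = nth x0 s i) (x \in segment x0 s a b).
Proof.
rewrite inE; apply: (iffP existsP) => [[i /andP[ai /eqP->]]|[i /andP[ai ib] ->]].
  by exists i; rewrite ?ai ?ltn_ord.
by exists (Ordinal ib); rewrite ai eqxx.
Qed.

Lemma mem_segment (x0 : T) s a b i :
  a <= i < b -> nth x0 s i \in segment x0 s a b.
Proof. by move=> ab; apply/segmentP; exists i. Qed.

Lemma segment_connected G (x0 : T) s a b :
    (forall i, a <= i -> i.+1 < b -> adjb G (nth x0 s i) (nth x0 s i.+1)) ->
  connected_in G (segment x0 s a b).
Proof.
move=> step; set S := segment _ _ _ _.
have from_a k : a + k < b ->
    connect (induced_adj G S) (nth x0 s a) (nth x0 s (a + k)).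
  elim: k => [|k IH]; rewrite ?addn0 // addnS => lt_b.
  apply: connect_trans (IH (ltnW lt_b)) (connect1 _).
  by rewrite /induced_adj !mem_segment ?step ?lt_b ?(ltnW lt_b) ?leq_addr //
    leqW ?leq_addr.
have from x : x \in S -> connect (induced_adj G S) (nth x0 s a) x.
  by case/segmentP => i /andP[ai ib] ->; rewrite -(subnKC ai) from_a ?subnKC.
move=> x y xS yS; apply: connect_trans (from y yS).
by rewrite induced_connectC from.
Qed.

Lemma cycle_step G s x0 i : induced_cycle G s -> i.+1 < size s ->
  adjb G (nth x0 s i) (nth x0 s i.+1).
Proof. by case=> _ _ Es lti; rewrite Es ?ltnSn // eqxx. Qed.

Lemma cycle_other_nbr G u y p : induced_cycle G (u :: y :: p) ->
  exists2 x, x \in p & adjb G u x.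
Proof.
case=> _ sz Es; exists (last y p).
  by case: p sz {Es} => //= z p _; apply: mem_last.
have := Es u 0 (size p).+1; rewrite /= ltnSn => /(_ isT).
by rewrite eqxx orbT (last_nth u).
Qed.

Definition sole_nbr G (u : T) A (q : T) :=
  q \in A /\ forall x, x \in A -> adjb G u x = (x == q).

(** This models the interior of one of the two arcs of a hole between [u] and [w]. The order along
    the arc is forgotten; the unique neighbours of [u] and [w] may coincide. *)
Definition arm G u w A :=
  [/\ connected_in G A, u \notin A, w \notin A,
      exists q, sole_nbr G u A q & exists q, sole_nbr G w A q].

Definition hole_arms G H u w A B :=
  [/\ arm G u w A, arm G u w B, A \subset H, B \subset H &
      forall x y, x \in A -> y \in B -> x != y /\ ~~ adjb G x y].

Lemma hole_armsP G H u w : hole G H -> u \in H -> w \in H -> u != w ->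
  ~~ adjb G u w -> exists A B, hole_arms G H u w A B.
Proof.
move=> hH uH wH nuw nadj; have [p [defH cp]] := cycle_of_hole hH uH.
move: (cp) => [Us sz Es]; set s := u :: p in defH Us sz Es cp.
have ws : w \in s by rewrite defH inE in wH.
pose m := index w s.
have mn : m < size s by rewrite index_mem.
have sm : nth u s m = w by rewrite nth_index.
have m1 : 0 < m by rewrite lt0n; apply: contraNneq nuw => m0; rewrite -sm m0.
(* As [u] and [w] are not adjacent, [m] is neither 1 nor the last index, so both arms are
   nonempty. *)
have := Es u 0 m; rewrite mn m1 sm -[nth u s 0]/u (negbTE nadj) /= => /(_ isT).
case/esym/norP => m2 m3.
have lt1m : 1 < m by rewrite ltn_neqAle eq_sym m2.
have ltmn : m.+1 < size s by rewrite ltn_neqAle m3.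
have nthE i j : i < size s -> j < size s -> (nth u s i == nth u s j) = (i == j).
  by move=> ? ?; rewrite nth_uniq.
have E0 i : 0 < i < size s -> adjb G u (nth u s i) = (i == 1) || (i.+1 == size s).
  by move=> /andP[i0 lti]; rewrite -[X in adjb G X _]/(nth u s 0) Es ?i0.
have Em i : 0 < i < size s -> adjb G w (nth u s i) = (i == m.-1) || (i == m.+1).
  move=> /andP[i0 lti]; rewrite -sm; case: (ltngtP i m) => [ltim|ltmi|->].
  - by rewrite adjbC Es ?ltim //; clear -ltim mn m3 i0; lia.
  - by rewrite Es ?ltmi //; clear -ltmi m1; lia.
  - by rewrite adjbxx; clear -m1; lia.
exists (segment u s 1 m), (segment u s m.+1 (size s)).
have sub a b : b <= size s -> segment u s a b \subset H.
  move=> leb; apply/subsetP => x /segmentP[i /andP[_ ib] ->].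
  by rewrite defH inE mem_nth // (leq_trans ib).
have notin a b k : b <= size s -> k < size s -> ~~ (a <= k < b) ->
    nth u s k \notin segment u s a b.
  move=> leb ltk; apply: contra => /segmentP[i /andP[ai ib] /eqP].
  by rewrite nthE ?(leq_trans ib) // => /eqP->; rewrite ai.
have sole v a b k : b <= size s -> a <= k < b ->
  (forall i, a <= i < b -> adjb G v (nth u s i) = (i == k)) ->
  exists q, sole_nbr G v (segment u s a b) q.
  move=> leb abk Ev; exists (nth u s k); split; first exact: mem_segment.
  move=> x /segmentP[i abi ->]; rewrite Ev // nthE //.
    by apply: leq_trans leb; case/andP: abi.
  by apply: leq_trans leb; case/andP: abk.
have s0 : 0 < size s by [].
split; rewrite ?sub ?(ltnW mn) //.
- split.
  + apply: segment_connected => i _ lti; apply: cycle_step => //.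
    exact: ltn_trans mn.
  + by rewrite -[u in u \notin _]/(nth u s 0) notin // ltnW.
  + by rewrite -[X in X \notin _]sm notin // ?(ltnW mn) // ltnn andbF.
  + apply: (sole _ _ _ 1) => // [|i /andP[i0 lti]]; first exact: ltnW.
    rewrite E0 ?i0 ?(ltn_trans lti) //; clear -lti ltmn; lia.
  + apply: (sole _ _ _ m.-1) => // [||i /andP[i0 lti]]; first exact: ltnW.
      by clear -lt1m; lia.
    rewrite Em ?i0 ?(ltn_trans lti) //; clear -lti; lia.
- split.
  + by apply: segment_connected => i _ lti; apply: cycle_step.
  + by rewrite -[u in u \notin _]/(nth u s 0) notin.
  + by rewrite -[X in X \notin _]sm notin // ltnn.
  + apply: (sole _ _ _ (size s).-1) => // [|i /andP[i0 lti]].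
      clear -ltmn; lia.
    rewrite E0 ?lti ?andbT ?(leq_ltn_trans _ i0) //; clear -i0 lti m1; lia.
  + apply: (sole _ _ _ m.+1) => // [|i /andP[i0 lti]]; first by rewrite leqnn.
    rewrite Em ?lti ?andbT ?(leq_ltn_trans _ i0) //; clear -i0; lia.
move=> x y /segmentP[i /andP[i1 im] ->] /segmentP[j /andP[j1 jn] ->].
rewrite nthE ?(ltn_trans im) // Es ?jn ?andbT; last by clear -im j1; lia.
by clear -im j1 i1; lia.
Qed.

(* A hole through the neighbours of w on both arms and Z would share with H
   the two edges at w. *)
Lemma NC_pinch G H u w A B Z : NC_vertex G u -> hole G H -> u \in H -> w \in H ->
    u != w -> hole_arms G H u w A B -> connected_in G Z ->
    u \notin Z -> w \notin Z -> (forall z, z \in Z -> ~~ adjb G w z) ->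
  touch G A Z -> touch G B Z -> False.
Proof.
move=> NCu hH uH wH nuw.
case=> [[cA uA wA _ [a [aA soleA]]] [cB uB wB _ [b [bB soleB]]] sAH sBH sepAB].
move=> cZ uZ wZ nwZ tAZ tBZ; apply: NCu.
have cAZ := connected_inU cA cZ tAZ.
have cS : connected_in G (A :|: Z :|: B).
  apply: connected_inU => //; case: tBZ => x [z [xB zZ xz]].
  exists z, x; rewrite !inE zZ orbT; split=> //.
  by case: xz => [->|xz]; [left | right; rewrite adjbC].
have [nab eab] := sepAB _ _ aA bB.
have wnbr z : z \in A :|: Z :|: B -> adjb G w z -> z = a \/ z = b.
  case/setUP => [/setUP[zA|zZ]|zB].
  - by rewrite soleA // => /eqP; left.
  - by rewrite (negbTE (nwZ _ zZ)).
  - by rewrite soleB // => /eqP; right.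
have wa : adjb G w a by rewrite soleA.
have wb : adjb G w b by rewrite soleB.
have [|||z zS wz|p [cp sub]] := apex_cycle (x := a) (y := b) cS _ _ _ nab wa wb.
- by rewrite !inE !negb_or wA wZ wB.
- by rewrite !inE aA.
- by rewrite !inE bB orbT.
- by have [->|->] := wnbr z zS wz; rewrite ?adjbxx // adjbC.
(* The cycle contains a second neighbour of [w] from the union, which can only be [a]. So it has
   both edges [wa] and [wb] of [H], and it avoids [u]. *)
have [x xp wx] := cycle_other_nbr cp.
have xa : x = a.
  have [//|xb] := wnbr x (sub _ (@mem_behead _ (b :: p) _ xp)) wx.
  by case: cp => /=; rewrite -xb xp andbF.
exists H, [set x in w :: b :: p]; split=> //; first exact: hole_of_cycle.
  rewrite inE inE (negbTE nuw) /=; apply/negP => /sub.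
  by rewrite !inE (negbTE uA) (negbTE uB) (negbTE uZ).
exists a, w, b; split=> //; first by apply/adjbP; rewrite adjbC.
- exact/adjbP.
- by rewrite wH (subsetP sAH) ?(subsetP sBH).
- by rewrite !inE -xa xp !eqxx !orbT.
Qed.

(** * Chordalizing by one vertex creates no hole *)

Definition on_hole G (u x : T) := exists H, [/\ hole G H, u \in H & x \in H].

Lemma on_holeV G u x : on_hole G u x -> (u \in gV G) && (x \in gV G).
Proof.
by case=> H [[s [_ _ -> sV _]]]; rewrite !inE => /sV-> /sV->.
Qed.

Lemma adj_local_chordalize G u x y : adj (local_chordalize G u) x y <->
  adj G x y \/ x != y /\ (x = u /\ on_hole G u y \/ y = u /\ on_hole G u x).
Proof.
split=> [[xV yV nxy [[|]|[|]]]|[[xV yV nxy E]|[nxy]]].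
- by left.
- by case=> eu _ ?; right; split=> //; left.
- by move/adjC; left.
- by case=> eu _ ?; right; split=> //; right.
- by split=> //=; left; left.
case=> [[eu oh]|[eu oh]]; subst; have /andP[uV zV] := on_holeV oh; split=> //=.
- by left; right; split=> //; apply/eqP; rewrite eq_sym.
- by right; right; split=> //; apply/eqP.
Qed.

Lemma adj_local_chordalize_off G u x y : x != u -> y != u ->
  adj (local_chordalize G u) x y <-> adj G x y.
Proof.
move=> /eqP xu /eqP yu; split=> [/adj_local_chordalize[//|[_ [[]|[]]]]//|Gxy].
by apply/adj_local_chordalize; left.
Qed.

Lemma adjb_local_chordalize_off G u x y : x != u -> y != u ->
  adjb (local_chordalize G u) x y = adjb G x y.
Proof.
by move=> xu yu; apply/adjbP/adjbP => /(adj_local_chordalize_off _ xu yu).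
Qed.

(* B is {b} when b is adjacent to u; otherwise one of the two arms of a hole
   through u and b stays away from a, by the pinching argument at b. *)
Lemma arm_avoiding G u a b : NC_vertex G u -> a != u -> b != u -> a != b ->
    ~~ adjb G a b -> adjb G u b \/ on_hole G u b ->
  exists B, [/\ connected_in G B, b \in B, u \notin B, exists q, sole_nbr G u B q
    & a \notin B /\ forall z, z \in B -> ~~ adjb G a z].
Proof.
move=> NCu au bu nab eab; have nbu : u != b by rewrite eq_sym.
have [ub _|nub [//|[H [hH uH bH]]]] := boolP (adjb G u b).
  exists [set b]; split; rewrite ?set11 ?inE //.
  - exact: connected_in1.
  - by exists b; split; rewrite ?set11 // => x /set1P->; rewrite ub eqxx.
  - by split=> // z /set1P->.
have [A [B arms]] := hole_armsP hH uH bH nbu nub.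
have away D : arm G u b D -> ~ touch G D [set a] -> exists B,
    [/\ connected_in G B, b \in B, u \notin B, exists q, sole_nbr G u B q
    & a \notin B /\ forall z, z \in B -> ~~ adjb G a z].
  case=> cD uD bD [q [qD soleq]] [c [cinD solec]] ntD; exists (D :|: [set b]); split.
  - apply: (connected_inU cD (@connected_in1 G b)).
    by exists c, b; rewrite set11; split=> //; right; rewrite adjbC solec.
  - by rewrite !inE eqxx orbT.
  - by rewrite !inE negb_or uD.
  - exists q; split; first by rewrite inE qD.
    move=> x /setUP[/soleq//|/set1P->]; rewrite (negbTE nub).
    by apply/esym/negbTE; apply: contraNneq bD => ->.
  split=> [|z /setUP[zD|/set1P->//]].
    rewrite !inE negb_or nab andbT; apply/negP => aD.
    by apply: ntD; exists a, a; rewrite set11; split=> //; left.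
  apply/negP => az; apply: ntD; exists z, a; rewrite set11.
  by split=> //; right; rewrite adjbC.
case: (pselect (touch G A [set a])) => [tA|];
  last by case: arms => hA _ _ _ _ /(away _ hA).
case: (pselect (touch G B [set a])) => [tB|];
  last by case: arms => _ hB _ _ _ /(away _ hB).
case: (NC_pinch NCu hH uH bH nbu arms (@connected_in1 G a) _ _ _ tA tB);
  rewrite ?inE 1?[_ == a]eq_sym //.
by move=> z /set1P->; rewrite adjbC.
Qed.

(* If A and B did not touch, a hole through u inside A, a, R and B would have
   to pass through R. *)
Lemma arms_touch G u a q A B R : arm G u a A -> connected_in G B -> u \notin B ->
    u != a -> ~~ adjb G u a -> sole_nbr G u B q ->
    (forall z, z \in B -> ~~ adjb G a z) ->
    a \notin B -> connected_in G R -> touch G [set a] R -> touch G R B ->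
    u \notin R -> (forall r, r \in R -> ~~ adjb G u r /\ ~ on_hole G u r) ->
  touch G A B.
Proof.
move=> [cA uA aA [p [pA solep]] [c [cinA solec]]] cB uB nua ua.
move=> [qB soleq] naB aB cR taR tRB uR farR.
case: (pselect (touch G A B)) => // ntAB; case: notF.
have sepAB x y : x \in A -> y \in B -> x != y /\ ~~ adjb G x y.
  move=> xA yB; split; [apply/eqP|apply/negP] => xy; apply: ntAB;
    by exists x, y; split; auto.
have cAa : connected_in G (A :|: [set a]).
  apply: (connected_inU cA (@connected_in1 G a)).
  by exists c, a; rewrite set11; split=> //; right; rewrite adjbC solec.
have cRB := connected_inU cR cB tRB.
have cS : connected_in G ((A :|: [set a]) :|: (R :|: B)).
  apply: connected_inU => //; case: taR => x [r [xa rR xr]].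
  by exists x, r; rewrite !inE rR; move: xa; rewrite inE => ->; rewrite orbT.
have [npq epq] := sepAB _ _ pA qB.
have up : adjb G u p by rewrite solep.
have uq : adjb G u q by rewrite soleq.
have [|||z|t [ct sub]] := apex_cycle (x := p) (y := q) cS _ _ _ npq up uq.
- by rewrite !inE !negb_or uA uB uR nua.
- by rewrite !inE pA.
- by rewrite !inE qB !orbT.
- case/setUP => [/setUP[zA|/set1P->]|/setUP[zR|zB]].
  + by rewrite solep // => /eqP->; rewrite adjbC.
  + by rewrite (negbTE ua).
  + by case: (farR _ zR) => /negbTE->.
  + by rewrite soleq // => /eqP->; rewrite adjbxx.
have subAB x : x \in q :: t -> x \in (A :|: [set a]) :|: B.
  move=> xt; have := sub x xt; rewrite !inE; case xR: (x \in R) => //.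
  case: (farR _ xR) => _ []; exists [set x in u :: q :: t].
  by rewrite !inE eqxx; split=> //; [apply: hole_of_cycle | rewrite -in_cons xt orbT].
(* The cycle enters [B] at [q] and avoids [R]. No edge leads from [B] to [A] or to [a], so it stays
   in [B], where [q] is the only neighbour of [u]; but the cycle needs a second one. *)
have allB i : i <= size t -> nth u (q :: t) i \in B.
  elim: i => [//|i IH] lti; have siB := IH (ltnW lti).
  have := cycle_step u (i := i.+1) ct; rewrite /= !ltnS => /(_ lti) step.
  have : nth u (q :: t) i.+1 \in q :: t by rewrite mem_nth.
  case/subAB/setUP=> // /setUP[xA|/set1P xa].
    by have [_ /negP[]] := sepAB _ _ xA siB; rewrite adjbC.
  by have /negP[] := naB _ siB; rewrite -xa adjbC.
have [x xt ux] := cycle_other_nbr ct.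
have xB : x \in B.
  by rewrite -(nth_index u xt); apply: (allB (index x t).+1); rewrite index_mem.
move: ux; rewrite soleq // => /eqP xq.
by case: ct => /=; rewrite -xq xt andbF.
Qed.

(** This excludes a new edge [ua] on a hole u, a, R, b. The set [B] leads from [b] back to [u] while
    avoiding [a] and its neighbours; by [arms_touch] both arms of the hole through [u] and [a] touch
    it, so [NC_pinch] applies at [a]. *)
Lemma no_detour G u a b R : NC_vertex G u -> a != u -> b != u -> a != b ->
    ~~ adjb G a b -> connected_in G R -> touch G [set a] R -> touch G R [set b] ->
    u \notin R -> (forall r, r \in R -> ~~ adjb G u r /\ ~ on_hole G u r) ->
    ~~ adjb G u a -> on_hole G u a -> adjb G u b \/ on_hole G u b -> False.
Proof.
move=> NCu au bu nab eab cR taR tRb uR farR ua [H [hH uH aH]] oub.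
have nua : u != a by rewrite eq_sym.
have [B [cB bB uB [q soleq] [aB naB]]] := arm_avoiding NCu au bu nab eab oub.
have [A1 [A2 arms]] := hole_armsP hH uH aH nua ua.
have tRB : touch G R B.
  by case: tRb => r [z [rR /set1P-> rb]]; exists r, b.
case: (arms) => h1 h2 _ _ _.
apply: (NC_pinch NCu hH uH aH nua arms cB uB aB naB).
  exact: arms_touch h1 cB uB nua ua soleq naB aB cR taR tRB uR farR.
exact: arms_touch h2 cB uB nua ua soleq naB aB cR taR tRB uR farR.
Qed.

Lemma hole_local_chordalize_notin G u H :
  NC_vertex G u -> hole (local_chordalize G u) H -> u \notin H.
Proof.
move=> NCu hH; apply/negP => uH; have [t [_ ct]] := cycle_of_hole hH uH.
move: (ct) => [Us sz Es]; set s := u :: t in Us sz Es ct.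
set n := size s in sz Es.
have nthu i : 0 < i < n -> nth u s i != u.
  move=> /andP[i0 lti]; rewrite -[X in _ != X]/(nth u s 0) nth_uniq //.
  by rewrite -lt0n.
have off i j : 0 < i -> i < j < n ->
    adjb G (nth u s i) (nth u s j) = (j == i.+1).
  move=> i0 /andP[ij jn]; rewrite -(@adjb_local_chordalize_off _ u) ?nthu ?i0 //.
  - by rewrite Es ?ij // eqn0Ngt i0 orbF.
  - exact: ltn_trans jn.
  - by rewrite jn andbT (leq_ltn_trans _ ij).
have Eu i : 0 < i < n ->
    adjb (local_chordalize G u) u (nth u s i) = (i == 1) || (i == n.-1).
  by move=> /andP[i0 lti]; rewrite -[u in adjb _ u _]/(nth u s 0) Es ?i0 //;
    clear -lti i0; lia.
have Gsub x : adjb G u x -> adjb (local_chordalize G u) u x.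
  by move=> /adjbP ux; apply/adjbP/adj_local_chordalize; left.
(* The indices 2 to n - 2, that is, the cycle without [u] and its two neighbours; this is nonempty
   because n is at least 4. *)
pose R := segment u s 2 n.-1.
have farR r : r \in R -> ~~ adjb G u r /\ ~ on_hole G u r.
  case/segmentP=> i /andP[i2 lti] ->.
  have i0n : 0 < i < n by clear -i2 lti; lia.
  have /negbT nad : adjb (local_chordalize G u) u (nth u s i) = false.
    by rewrite Eu //; clear -i2 lti; lia.
  split; first by apply: contra nad => /Gsub.
  move=> oh; case/negP: nad; apply/adjbP/adj_local_chordalize; right.
  by split; [rewrite eq_sym nthu | left].
have uR : u \notin R.
  apply/segmentP=> -[i /andP[i2 lti] eu].
  by have := nthu i; rewrite -eu eqxx => /(_ _)/negP[] //; clear -i2 lti; lia.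
have cR : connected_in G R.
  apply: segment_connected => i i2 lti.
  by rewrite off ?eqxx ?ltnSn ?(leq_trans _ i2) //=; clear -lti; lia.
set a := nth u s 1; set b := nth u s n.-1.
have au : a != u by apply: nthu; clear -sz; lia.
have bu : b != u by apply: nthu; clear -sz; lia.
have nab : a != b by rewrite nth_uniq //; clear -sz; rewrite -/n; lia.
have eab : ~~ adjb G a b by rewrite off //; clear -sz; lia.
have taR : touch G [set a] R.
  exists a, (nth u s 2); rewrite set11 mem_segment; last by clear -sz; lia.
  by split=> //; right; rewrite off // ; clear -sz; lia.
have tbR : touch G R [set b].
  exists (nth u s n.-2), b; rewrite set11 mem_segment; last by clear -sz; lia.
  by split=> //; right; rewrite off // ; clear -sz; lia.
have nbr x : adjb (local_chordalize G u) u x -> x != u -> adjb G u x \/ on_hole G u x.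
  move=> /adjbP/adj_local_chordalize[/adjbP ux|[_ [[_ oh]|[-> _]]]]; [by left|by right|].
  by rewrite eqxx.
have oa : adjb G u a \/ on_hole G u a.
  by apply: nbr => //; rewrite Eu //; clear -sz; lia.
have ob : adjb G u b \/ on_hole G u b.
  by apply: nbr => //; rewrite Eu ?eqxx ?orbT //; clear -sz; lia.
(* A new edge at [u] is excluded by [no_detour], at [a] directly and at [b] by traversing [R]
   backwards. *)
have [ua|nua] := boolP (adjb G u a); last first.
  case: oa => [ua|oa]; first by rewrite ua in nua.
  exact: (no_detour NCu au bu nab eab cR taR tbR uR farR nua oa ob).
have [ub|nub] := boolP (adjb G u b); last first.
  case: ob => [ub|ob]; first by rewrite ub in nub.
  rewrite eq_sym in nab; rewrite adjbC in eab.
  exact: (no_detour NCu bu au nab eab cR (touchC tbR) (touchC taR) uR farR nub ob oa).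
(* With both edges at [u] old, the cycle is already a hole of [G], so its vertices in [R] lie on a
   hole with [u], against [farR]. *)
have cG : induced_cycle G s.
  split=> // x0 i j /andP[ij jn]; rewrite -/n.
  rewrite !(set_nth_default u x0) // ?(ltn_trans ij) //.
  case: i ij => [|i] ij; last by rewrite off ?ij //= orbF.
  rewrite -[nth u s 0]/u; apply/idP/idP => [/Gsub|].
    by rewrite Eu ?ij //=; clear -ij jn; lia.
  by case/orP=> [/eqP->//|/=]; rewrite -[n]prednK 1?eqSS => [/eqP->//|]; clear -sz; lia.
have rR : nth u s 2 \in R by rewrite mem_segment; clear -sz; lia.
case: (farR _ rR) => _ []; exists [set x in s]; split; first exact: hole_of_cycle.
  by rewrite !inE eqxx.
by rewrite inE mem_nth // -/n; clear -sz; lia.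
Qed.

(** The hole avoids [u], and adjacency away from [u] has not changed. *)
Lemma hole_local_chordalize G u H :
  NC_vertex G u -> hole (local_chordalize G u) H -> hole G H.
Proof.
move=> NCu hH; have uH := hole_local_chordalize_notin NCu hH.
case: hH uH => s [Us sz -> sV Es] uH; exists s; split=> // x y xs ys.
have neu z : z \in s -> z != u by apply: contraTneq => ->; move: uH; rewrite inE.
exact: iff_trans (iff_sym (adj_local_chordalize_off _ (neu _ xs) (neu _ ys)))
  (Es _ _ xs ys).
Qed.

(** * Iterated chordalization and the hat graph *)

Lemma NC_local_chordalize G u v :
  NC_vertex G u -> NC_vertex G v -> NC_vertex (local_chordalize G u) v.
Proof.
move=> NCu NCv [H [H' [hH hH' vH vH' [a [b [c [nac ab bc inH inH']]]]]]].
have uH := hole_local_chordalize_notin NCu hH.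
have neu z : z \in H -> z != u by apply: contraTneq => ->.
case: (inH) => /neu au /neu bu /neu cu.
apply: NCv; exists H, H'; split=> //; try exact: (hole_local_chordalize NCu).
by exists a, b, c; split=> //; apply/(@adj_local_chordalize_off _ u).
Qed.

(** The NC property of the remaining vertices survives each step, so the induction goes through.
    Since holes only disappear, every new edge is explained by a hole of the initial graph. *)
Lemma foldl_local_chordalize G us : (forall u, u \in us -> NC_vertex G u) ->
  let G' := foldl (@local_chordalize T) G us in
  [/\ gV G' = gV G, forall x y, adj G x y -> adj G' x y &
    forall x y, adj G' x y -> adj G x y \/
      x != y /\ (x \in us /\ on_hole G x y \/ y \in us /\ on_hole G y x)].
Proof.
elim: us G => [|u us IH] G NC /=; first by split=> // x y; left.
have NCu : NC_vertex G u by apply: NC; rewrite mem_head.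
have [|eV subG newG] := IH (local_chordalize G u).
  by move=> v vus; apply: NC_local_chordalize => //; apply: NC; rewrite inE vus orbT.
have hole_sub v z : on_hole (local_chordalize G u) v z -> on_hole G v z.
  by case=> H [hH vH zH]; exists H; split=> //; apply: hole_local_chordalize hH.
split=> // [x y Gxy|x y /newG[/adj_local_chordalize[|[nxy]]|[nxy]]].
- by apply/subG/adj_local_chordalize; left.
- by left.
- by case=> [[eu oh]|[eu oh]]; right; split=> //; [left|right]; rewrite eu mem_head.
- case=> [[v oh]|[v oh]]; right; split=> //; [left|right]; rewrite inE v orbT;
    by split=> //; apply: hole_sub.
Qed.

Lemma hatG_spec G A : NC_set G A ->
  [/\ gV (hatG G A) = gV G, forall x y, adj G x y -> adj (hatG G A) x y &
    forall x y, adj (hatG G A) x y -> adj G x y \/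
      x != y /\ (x \in A /\ on_hole G x y \/ y \in A /\ on_hole G y x)].
Proof.
case=> NCA _; have [|eV subG newG] := @foldl_local_chordalize G (enum A).
  by move=> u; rewrite mem_enum => /NCA.
by split=> // x y /newG; rewrite !mem_enum.
Qed.

(** * Cliques of the hat graph *)

Lemma NC_set_hole G A H x y : NC_set G A -> hole G H ->
  x \in H -> y \in H -> x \in A -> y \in A -> x = y.
Proof.
case=> _ /[apply] /card_le1_eqP le1 xH yH xA yA.
by apply: le1; rewrite inE ?xH ?yH.
Qed.

(* Since no hole contains both u and v, the edge uv forces v to touch both arms
   of the hole through u, or u both arms of the hole through v. *)
Lemma no_common_fill G A u v w : NC_set G A -> u \in A -> v \in A -> u != v ->
    adjb G u v -> on_hole G u w -> on_hole G v w -> u != w -> v != w ->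
    ~~ adjb G u w -> ~~ adjb G v w -> False.
Proof.
move=> NCA uA vA nuv uv [H [hH uH wH]] [H' [hH' vH' wH']] nuw nvw euw evw.
have vH : v \notin H by apply: contra nuv => vH; apply/eqP/(NC_set_hole NCA hH).
have uH' : u \notin H' by apply: contra nuv => uH'; apply/eqP/(NC_set_hole NCA hH').
have [P1 [P2 armsP]] := hole_armsP hH uH wH nuw euw.
have [Q1 [Q2 armsQ]] := hole_armsP hH' vH' wH' nvw evw.
have [NCu NCv] : NC_vertex G u /\ NC_vertex G v by case: NCA => NC _; split; apply: NC.
case: (armsP) => aP1 aP2 sP1 sP2 _; case: (armsQ) => aQ1 aQ2 sQ1 sQ2 _.
(* Otherwise the connected set formed by [P], [w], [Q] and [v] would give a hole through [u] that
   uses the edge [uv], hence a hole meeting [A] twice. *)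
have cross P Q : arm G u w P -> P \subset H -> arm G v w Q -> Q \subset H' ->
    touch G P [set v] \/ touch G Q [set u].
  case=> cP uP wP [p [pP solep]] [c [cinP solec]] sPH.
  case=> cQ vQ wQ [q [qQ soleq]] [d [dQ soled]] sQH'.
  case: (pselect (touch G P [set v])) => [|ntP]; first by left.
  case: (pselect (touch G Q [set u])) => [|ntQ]; first by right.
  have notinP : v \notin P by apply: contra vH => /(subsetP sPH).
  have notinQ : u \notin Q by apply: contra uH' => /(subsetP sQH').
  have cPw : connected_in G (P :|: [set w]).
    apply: (connected_inU cP (@connected_in1 G w)).
    by exists c, w; rewrite set11; split=> //; right; rewrite adjbC solec.
  have cQv : connected_in G (Q :|: [set v]).
    apply: (connected_inU cQ (@connected_in1 G v)).
    by exists q, v; rewrite set11; split=> //; right; rewrite adjbC soleq.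
  have cS : connected_in G ((P :|: [set w]) :|: (Q :|: [set v])).
    apply: connected_inU => //; exists w, d; rewrite !inE eqxx dQ orbT.
    by split=> //; right; rewrite soled.
  have npv : p != v by apply: contraNneq notinP => <-.
  have up : adjb G u p by rewrite solep.
  have [|||z|t [ct _]] := apex_cycle (x := p) (y := v) cS _ _ _ npv up uv.
  - by rewrite !inE !negb_or uP nuw notinQ.
  - by rewrite !inE pP.
  - by rewrite !inE eqxx !orbT.
  - case/setUP => [/setUP[zP|/set1P->]|/setUP[zQ|/set1P->]]; rewrite ?adjbxx //.
      move=> _; apply/negP => vz; apply: ntP; exists z, v.
      by rewrite set11; split=> //; right; rewrite adjbC.
    move=> uz; case: ntQ; exists z, u.
    by rewrite set11; split=> //; right; rewrite adjbC.
  case/eqP: nuv; apply: (NC_set_hole NCA (hole_of_cycle ct)) => //.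
    by rewrite !inE eqxx.
  by rewrite !inE eqxx orbT.
have pinchP : touch G P1 [set v] -> touch G P2 [set v] -> False.
  apply: (NC_pinch NCu hH uH wH nuw armsP (@connected_in1 G v)).
  - by rewrite inE.
  - by rewrite inE eq_sym.
  - by move=> z /set1P->; rewrite adjbC.
have pinchQ : touch G Q1 [set u] -> touch G Q2 [set u] -> False.
  apply: (NC_pinch NCv hH' vH' wH' nvw armsQ (@connected_in1 G u)).
  - by rewrite inE eq_sym.
  - by rewrite inE eq_sym.
  - by move=> z /set1P->; rewrite adjbC.
(* By pinching, one of the P arms does not touch [v] and one of the Q arms does not touch [u];
   [cross] fails for this pair. *)
have c11 := cross _ _ aP1 sP1 aQ1 sQ1; have c12 := cross _ _ aP1 sP1 aQ2 sQ2.
have c21 := cross _ _ aP2 sP2 aQ1 sQ1; have c22 := cross _ _ aP2 sP2 aQ2 sQ2.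
by tauto.
Qed.

Lemma hole4 G a b c d : adjb G a b -> adjb G b c -> adjb G c d -> adjb G d a ->
  a != c -> b != d -> ~~ adjb G a c -> ~~ adjb G b d ->
  hole G [set x in [:: a; b; c; d]].
Proof.
move=> ab bc cd da nac nbd eac ebd; apply: hole_of_cycle.
have neq x y : adjb G x y -> x != y by case/adjbP.
rewrite adjbC in da; split=> //=.
  by rewrite !inE !negb_or nac nbd !(neq a b, neq a d, neq b c, neq c d).
by move=> x0 [|[|[|[|i]]]] [|[|[|[|j]]]] /andP[] //= _ _;
  rewrite ?ab ?bc ?cd ?da ?(negbTE eac) ?(negbTE ebd).
Qed.

Lemma clique_hatG G A K : NC_set G A -> clique (hatG G A) K ->
  exists D : {set T}, [/\ D \subset K :&: A, #|D| <= 1 & clique G (K :\: D)].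
Proof.
move=> NCA [KV Kadj]; have [eV subG newG] := hatG_spec NCA.
rewrite eV in KV.
(* The pairs in [K] that are not adjacent in [G], oriented from their end in [A]; [fillA] below
   shows that the other end is outside [A]. *)
pose fill u w := [/\ u \in K, w \in K, u \in A, on_hole G u w
  & u != w /\ ~~ adjb G u w].
have fillP x y : x \in K -> y \in K -> x != y -> adjb G x y \/ fill x y \/ fill y x.
  move=> xK yK nxy; have [xy|exy] := boolP (adjb G x y); first by left.
  right; case: (newG _ _ (Kadj _ _ xK yK nxy)) => [xy|[_]].
    by case/adjbP: exy.
  case=> -[inA oh]; [left | right]; split=> //; split=> //; first by rewrite eq_sym.
  by rewrite adjbC.
have fillA u w : fill u w -> w \notin A.
  case=> _ _ uA [H [hH uH wH]] [nuw _]; apply: contra nuw => wA.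
  exact/eqP/(NC_set_hole NCA hH).
have fill_unique u w v z : fill u w -> fill v z -> u = v.
  move=> fu fv; apply/eqP; apply: contraT => nuv; case: notF.
  have wA := fillA _ _ fu; have zA := fillA _ _ fv.
  case: (fu) => uK wK uA ouw [nuw euw]; case: (fv) => vK zK vA ovz [nvz evz].
  have uv : adjb G u v.
    case: (fillP u v uK vK nuv) => [//|[/fillA|/fillA]]; first by rewrite vA.
    by rewrite uA.
  have nvw : v != w by apply: contraNneq wA => <-.
  have nuz : u != z by apply: contraNneq zA => <-.
  have common := no_common_fill NCA uA vA nuv uv.
  (* If [vw] were new, [w] would be joined by new edges to both [u] and [v]. *)
  have vw : adjb G v w.
    case: (fillP v w vK wK nvw) => [//|[fvw|[_ _ wA']]]; last by rewrite wA' in wA.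
    by case: fvw => _ _ _ ovw [_ evw]; case: (common w).
  have uz : adjb G u z.
    case: (fillP u z uK zK nuz) => [//|[fuz|[_ _ zA']]]; last by rewrite zA' in zA.
    by case: fuz => _ _ _ ouz [_ euz]; case: (common z).
  have nzw : z != w by apply: contraNneq euw => <-.
  have zw : adjb G z w.
    by case: (fillP z w zK wK nzw) => [//|[[_ _ inA]|[_ _ inA]]];
      [rewrite inA in zA | rewrite inA in wA].
  (* In the 4-cycle u, z, w, v the diagonals [uw] and [zv] are missing in [G], so it is a hole
     meeting [A] twice. *)
  rewrite adjbC in vw; rewrite adjbC in uv.
  have hH := hole4 uz zw vw uv nuw; rewrite eq_sym in nvz; rewrite adjbC in evz.
  case/eqP: nuv; apply: (NC_set_hole NCA (hH nvz euw evz)) => //;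
    by rewrite !inE eqxx ?orbT.
case: (pselect (exists u w, fill u w)) => [[u [w fu]]|nofill].
  exists [set u]; case: (fu) => uK _ uA _ _; split.
  - by rewrite sub1set inE uK.
  - by rewrite cards1.
  split=> [|x y]; first exact: subset_trans (subsetDl _ _) KV.
  rewrite !inE => /andP[nxu xK] /andP[nyu yK] nxy; apply/adjbP.
  case: (fillP x y xK yK nxy) => [//|[fx|fy]].
    by rewrite (fill_unique _ _ _ _ fx fu) eqxx in nxu.
  by rewrite (fill_unique _ _ _ _ fy fu) eqxx in nyu.
exists set0; rewrite sub0set cards0 setD0; split=> //; split=> // x y xK yK nxy.
apply/adjbP; case: (fillP x y xK yK nxy) => [//|[f|f]]; case: nofill;
  by [exists x, y | exists y, x].
Qed.

(** * Descent along the chordalization chain *)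

Section Chain.
Variables (G : graph T) (C : {set T}) (Cs : seq {set T}).
Hypotheses (CV : C \subset gV G)
  (Cs_part : local_chordalization_partition G C Cs).

Lemma part_subset i : i < size Cs -> part Cs i.+1 \subset gV G.
Proof.
case: Cs_part => _ _ defC _ lti; apply: subset_trans CV; rewrite -defC.
apply/subsetP => x xi; rewrite bigcup_seq; apply/bigcupP; exists (part Cs i.+1) => //.
exact: mem_nth.
Qed.

Lemma later_partsE i : i < size Cs ->
  later_parts Cs i = part Cs i.+1 :|: later_parts Cs i.+1.
Proof. by move=> lti; rewrite /later_parts (drop_nth set0 lti) big_cons. Qed.

Lemma part_disjoint i j x : i < size Cs -> j < size Cs -> i != j ->
  x \in part Cs i.+1 -> x \notin part Cs j.+1.
Proof.
case: Cs_part => _ dis _ _ lti ltj; case: ltngtP => // [ij|ji] _.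
  by move=> xi; rewrite (disjointFr (dis i j _) xi) ?ij.
by move=> xi; rewrite (disjointFl (dis j i _) xi) ?ji.
Qed.

Lemma part_notin_later i x : i < size Cs -> x \in part Cs i.+1 ->
  x \notin later_parts Cs i.+1.
Proof.
move=> lti xi; rewrite /later_parts bigcup_seq.
apply/bigcupP => -[A /(nthP set0)[k]].
rewrite size_drop nth_drop => ltk <- xk.
have ltik : i.+1 + k < size Cs by rewrite -ltn_subRL.
have nik : i != i.+1 + k by rewrite neq_ltn addSn ltnS leq_addr.
by case/negP: (part_disjoint lti ltik nik xi).
Qed.

Lemma NC_part i : i < size Cs ->
  NC_set (step_graph G Cs (chain_star G C Cs i) i.+1) (part Cs i.+1).
Proof.
by case: Cs_part => _ _ _ chain lti; case: (chain i.+1); rewrite ?lti.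
Qed.

Lemma gV_chain_star i : i <= size Cs ->
  gV (chain_star G C Cs i) = gV G :\: later_parts Cs i.
Proof.
elim: i => [_|i IH lti]; rewrite /=.
  by case: Cs_part => _ _ <- _; rewrite /later_parts drop0.
have [-> _ _] := hatG_spec (NC_part lti); rewrite /= IH ?(ltnW lti) //.
rewrite (later_partsE lti); apply/setP => x; rewrite !inE.
case xi: (x \in part Cs i.+1) => /=; last by rewrite orbF.
by rewrite (negbTE (part_notin_later lti xi)) (subsetP (part_subset lti)).
Qed.

(** [step_graph] puts in all edges of [G] between the vertices present so far, and chordalizing only
    adds edges. *)
Lemma adj_chain_star i x y : i <= size Cs ->
  adj (delete G (later_parts Cs i)) x y -> adj (chain_star G C Cs i) x y.
Proof.
case: i => [_|i lti] Gxy.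
  by move: Gxy; case: Cs_part => _ _ <- _; rewrite /later_parts drop0.
have [eV subG _] := hatG_spec (NC_part lti); apply: subG.
have gVE := gV_chain_star lti; rewrite /= eV in gVE.
case: (Gxy) => xV yV nxy _; split; rewrite ?gVE //.
by left; right.
Qed.

Lemma adj_delete S x y : adj (delete G S) x y -> adj G x y.
Proof. by case; rewrite !inE => /andP[_ xV] /andP[_ yV] nxy E; split. Qed.

Lemma adj_step_graph i x y : i < size Cs ->
    adj (step_graph G Cs (chain_star G C Cs i) i.+1) x y ->
  adj (chain_star G C Cs i) x y \/ adj G x y.
Proof.
move=> lti [_ _ _ [[|/adj_delete]|[/adjC|/adjC/adj_delete]]]; by [left|right].
Qed.

Lemma clique_chain_star i K : i <= size Cs -> clique (chain_star G C Cs i) K ->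
  exists Cst : {set T}, [/\ Cst \subset K :&: C, clique G (K :\: Cst) &
    forall j, j < size Cs -> #|Cst :&: part Cs j.+1| <= 1].
Proof.
elim: i K => [|i IH] K lei clK.
  exists set0; rewrite sub0set setD0; split=> // [|j _]; last by rewrite set0I cards0.
  case: clK => KV Kadj; split=> [|x y xK yK nxy].
    exact: subset_trans KV (subsetDl _ _).
  exact: adj_delete (Kadj _ _ xK yK nxy).
have [D [DKC D1 [K1V K1adj]]] := clique_hatG (NC_part lei) clK.
have gVE := gV_chain_star (ltnW lei).
(* The vertices of the newest part are absent from the previous graph, so before chordalization all
   edges at them come from [G]. *)
have notV x : x \in part Cs i.+1 -> x \notin gV (chain_star G C Cs i).
  by move=> xi; rewrite gVE later_partsE // !inE xi.
have KV : K \subset gV G.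
  case: clK => KV _; apply: subset_trans KV _.
  by rewrite gV_chain_star // subsetDl.
have inV x : x \in K :\: D -> x \notin part Cs i.+1 -> x \in gV (chain_star G C Cs i).
  by move=> /(subsetP K1V) /setUP[//|->].
(* The whole newest part is taken out, not only [D], so that the set given by induction is disjoint
   from it. *)
have cl2 : clique (chain_star G C Cs i) ((K :\: D) :\: part Cs i.+1).
  split=> [|x y /setDP[xK xi] /setDP[yK yi] nxy].
    by apply/subsetP => x /setDP[xK xi]; apply: inV.
  have [//|[_ _ _ E]] := adj_step_graph lei (K1adj _ _ xK yK nxy).
  apply: adj_chain_star; first exact: ltnW.
  by split; rewrite //= -gVE inV.
have [Cst [CstK clG Cst1]] := IH _ (ltnW lei) cl2.
have CstP x : x \in Cst -> [/\ x \in K, x \in C & x \notin part Cs i.+1].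
  by move=> /(subsetP CstK); rewrite !inE => /andP[/and3P[-> _ ->] ->].
have DP x : x \in D -> (x \in K) && (x \in part Cs i.+1).
  by move=> /(subsetP DKC); rewrite inE.
(* [D] lies in the newest part and [Cst] outside it, so each part meets at most one of the two
   sets. *)
exists (Cst :|: D); split.
- apply/subsetP => x /setUP[/CstP[xK xC _]|/DP/andP[xK xi]]; rewrite inE xK //.
  case: Cs_part => _ _ <- _; rewrite bigcup_seq.
  apply/bigcupP; exists (part Cs i.+1) => //.
    exact: mem_nth.
- split=> [|x y]; first exact: subset_trans (subsetDl _ _) KV.
  have sep z : z \in K :\: (Cst :|: D) ->
      z \in K :\: D /\
        (z \notin part Cs i.+1 -> z \in (K :\: D) :\: part Cs i.+1 :\: Cst).
    rewrite !inE negb_or => /andP[/andP[-> ->] ->]; split=> // ->.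
    by [].
  move=> /sep[xK xi] /sep[yK yi] nxy.
  (* Two vertices outside the newest part are adjacent by induction; if one lies in it, [notV] shows
     that the edge is one of [G]. *)
  have [|] := boolP ((x \in part Cs i.+1) || (y \in part Cs i.+1)); last first.
    by case/norP=> /xi xK2 /yi yK2; case: clG => _; apply.
  have [|//] := adj_step_graph lei (K1adj _ _ xK yK nxy).
  by case=> xV yV _ _ /orP[/notV|/notV]; rewrite ?xV ?yV.
move=> j ltj; have [eji|nji] := eqVneq j i.
  apply: leq_trans D1; apply/subset_leq_card/subsetP => x.
  rewrite eji inE => /andP[/setUP[/CstP[_ _ /negbTE->]|]//].
apply: leq_trans (Cst1 j ltj); apply/subset_leq_card/subsetP => x.
rewrite inE => /andP[/setUP[xC xj|/DP/andP[_ xi]]]; first by rewrite inE xC.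
by rewrite (negbTE (part_disjoint _ _ _ xi)) // eq_sym.
Qed.

End Chain.
End Adjacency.

Theorem theorem4p3 (T : finType) (G : graph T) (C : {set T})
  (Cs : seq {set T}) (K : {set T}) :
  hole_cover G C ->
  local_chordalization_partition G C Cs ->
  K \subset gV G ->
  clique (chain_star G C Cs (size Cs)) K ->
  exists Cst : {set T},
    [/\ Cst \subset K :&: C,
        clique G (K :\: Cst) &
        forall i, 1 <= i <= size Cs -> #|Cst :&: part Cs i| <= 1].
Proof.
move=> [CV _ _] Cs_part _ clK.
have [Cst [sub clG le1]] := clique_chain_star CV Cs_part (leqnn _) clK.
by exists Cst; split=> // -[//|i] /andP[_ lti]; apply: le1.
Qed.
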